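(* Let $X:\Sigma^n\to\mathbb{R}^{n+m}$ ($n,m\ge 1$) be a complete $\lambda$-self-shrinker for the mean curvature flow (MCF) with respect to $\vec 0\in\mathbb{R}^{n+m}$, $\lambda>0$. Suppose that $\Sigma$ is parabolic. Then: (1) either there exists a point $p\in\Sigma$ such that $\|X(p)\|>\sqrt{\frac n\lambda}$, (2) or $X(\Sigma)\subseteq S^{n+m-1}\big(\sqrt{\tfrac n\lambda}\big)$ and $X:\Sigma^n\to S^{n+m-1}\big(\sqrt{\tfrac n\lambda}\big)$ is a minimal immersion.
   Context: A complete isometric immersion $X:\Sigma^n\to\mathbb{R}^{n+m}$ of an $n$-dimensional Riemannian manifold is a $\lambda$-self-shrinker for the MCF with respect to $\vec 0$ if $\lambda>0$ and $\vec H=-\lambda X^\perp$, where $\vec H$ is the mean curvature vector of $X$ (the trace of the second fundamental form, so $\vec H=\Delta^\Sigma X$) and $X^\perp$ is the component of the position vector $X$ normal to $\Sigma$. $S^{n+m-1}(R)$ is the sphere of radius $R$ centered at $\vec 0$ in $\mathbb{R}^{n+m}$. A complete Riemannian manifold $M$ is parabolic if every continuous subharmonic function $u:M\to\mathbb{R}$ ($\Delta u\ge 0$ when $u\in C^2$) with $\sup_M u<\infty$ is constant (compact connected manifolds have this property). *)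

(* Defs.v *)
From mathcomp Require Export all_boot all_order all_algebra.
From mathcomp Require Export all_classical all_reals all_analysis.
Export Order.TTheory GRing.Theory Num.Theory numFieldNormedType.Exports.

Set Implicit Arguments.
Unset Strict Implicit.
Unset Printing Implicit Defensive.

Local Open Scope classical_set_scope.
Local Open Scope ring_scope.

(* The library norm on ['rV[R]_N] is the sup norm, hence the explicit
   Euclidean structure. *)
Definition dot (R : realType) (N : nat) (u v : 'rV[R]_N) : R :=
  \sum_(k < N) u 0 k * v 0 k.

Definition enorm (R : realType) (N : nat) (u : 'rV[R]_N) : R :=
  Num.sqrt (dot u u).

Definition esphere (R : realType) (N : nat) (r : R) : set 'rV[R]_N :=
  [set y | enorm y = r].

Definition partial (R : realType) (n : nat) (i : 'I_n) (f : 'rV[R]_n -> R) :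
    'rV[R]_n -> R :=
  fun x => 'D_(delta_mx 0 i) f x.

(* [f] is of class C^k on the open set [U]. *)
Fixpoint class_C (R : realType) (n k : nat) (U : set 'rV[R]_n)
    (f : 'rV[R]_n -> R) : Prop :=
  (forall x, U x -> {for x, continuous f}) /\
  match k with
  | 0 => True
  | k'.+1 => forall i : 'I_n,
      (forall x, U x -> derivable f x (delta_mx 0 i)) /\
      class_C k' U (partial i f)
  end.

(* A homeomorphism from the open set [cdom] of [T] onto the open set [ccodom]
   of R^n; the values of [cmap] and [cinv] outside these sets are irrelevant. *)
Record chart (R : realType) (T : topologicalType) (n : nat) := Chart {
  cdom : set T;
  ccodom : set 'rV[R]_n;
  cmap :> T -> 'rV[R]_n;
  cinv : 'rV[R]_n -> T;
  cdom_open : open cdom;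
  ccodom_open : open ccodom;
  cmap_codom : forall p, cdom p -> ccodom (cmap p);
  cinv_dom : forall x, ccodom x -> cdom (cinv x);
  cmapK : forall p, cdom p -> cinv (cmap p) = p;
  cinvK : forall x, ccodom x -> cmap (cinv x) = x;
  cmap_continuous : forall p, cdom p -> {for p, continuous cmap};
  cinv_continuous : forall x, ccodom x -> {for x, continuous cinv} }.

(* Matrix of the differential of [F] in the chart [c]: row [i] is the
   derivative of [F \o cinv c] in the direction of the [i]-th coordinate. *)
Definition diff_mx (R : realType) (T : topologicalType) (n N : nat)
    (c : chart R T n) (F : T -> 'rV[R]_N) (x : 'rV[R]_n) : 'M[R]_(n, N) :=
  \matrix_(i, k) partial i (fun y => F (cinv c y) 0 k) x.

Record manifold (R : realType) (n : nat) := Manifold {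
  carrier :> topologicalType;
  manifold_hausdorff : hausdorff_space carrier;
  manifold_second_countable : @second_countable carrier;
  atlas : set (chart R carrier n);
  chart_at : carrier -> chart R carrier n;
  chart_at_atlas : forall p, atlas (chart_at p);
  chart_at_dom : forall p, cdom (chart_at p) p;
  transition_smooth : forall c d, atlas c -> atlas d -> forall (l : nat) k,
    class_C l [set x | ccodom c x /\ cdom d (cinv c x)]
      (fun x => d (cinv c x) 0 k) }.

(* [metric c x] is the Gram matrix, at the point of coordinates [x], of the
   coordinate frame of the chart [c]. *)
Record riemannian (R : realType) (n : nat) := Riemannian {
  base :> manifold R n;
  metric : chart R base n -> 'rV[R]_n -> 'M[R]_n;
  metric_sym : forall c, atlas c -> forall x, ccodom c x ->
    (metric c x)^T = metric c x;
  metric_pos : forall c, atlas c -> forall x, ccodom c x ->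
    forall v : 'rV[R]_n, v != 0 -> 0 < dot (v *m metric c x) v;
  metric_smooth : forall c, atlas c -> forall (l : nat) i j,
    class_C l (ccodom c) (fun x => metric c x i j);
  metric_transition : forall c d, atlas c -> atlas d ->
    forall x, ccodom c x -> cdom d (cinv c x) ->
    metric c x =
      diff_mx c d x *m metric d (d (cinv c x)) *m (diff_mx c d x)^T }.

Definition C_on (R : realType) (n k : nat) (M : manifold R n) (U : set M)
    (f : M -> R) : Prop :=
  forall c : chart R M n, atlas c ->
    class_C k [set x | ccodom c x /\ U (cinv c x)] (fun x => f (cinv c x)).

Definition smooth_map (R : realType) (n N : nat) (M : manifold R n)
    (X : M -> 'rV[R]_N) : Prop :=
  forall (l : nat) (k : 'I_N), C_on l [set: M] (fun p => X p 0 k).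

Section Completeness.
Variables (R : realType) (n : nat) (M : riemannian R n).

(* Velocity of [g] at time [t] in the coordinates of the chart [c]. *)
Definition velocity (c : chart R M n) (g : R -> M) (t : R) : 'rV[R]_n :=
  \row_k derive1 (fun s => c (g s) 0 k) t.

Definition C1_curve (g : R -> M) : Prop :=
  continuous g /\
  forall c : chart R M n, atlas c -> forall t, cdom c (g t) -> forall k,
    derivable (fun s => c (g s) 0 k) t 1 /\
    {for t, continuous (fun s => velocity c g s 0 k)}.

Definition speed (g : R -> M) (t : R) : R :=
  let c := chart_at (g t) in
  let v := velocity c g t in
  Num.sqrt (dot (v *m metric c (c (g t))) v).

Definition curve_length (g : R -> M) : \bar R :=
  (\int[lebesgue_measure]_(t in `[0%R, 1%R]) (speed g t)%:E)%E.

(* [piecewise_length p q l]: some piecewise C^1 curve from [p] to [q] has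
   length [l].  Each piece is parametrised by [0, 1]; it is C^1 up to the end
   points, which is expressed by a C^1 extension to the whole line. *)
Inductive piecewise_length : M -> M -> \bar R -> Prop :=
| piecewise_nil p : piecewise_length p p 0%E
| piecewise_cons (g : R -> M) q l : C1_curve g ->
    piecewise_length (g 1) q l ->
    piecewise_length (g 0) q (curve_length g + l)%E.

Definition riemannian_dist (p q : M) : \bar R :=
  ereal_inf [set l | piecewise_length p q l].

Definition complete_riemannian : Prop :=
  forall u : nat -> M,
    (forall e : R, 0 < e -> exists N, forall i j, (N <= i)%N -> (N <= j)%N ->
       (riemannian_dist (u i) (u j) < e%:E)%E) ->
    exists p, forall e : R, 0 < e -> exists N, forall i, (N <= i)%N ->
       (riemannian_dist (u i) p < e%:E)%E.

End Completeness.

Section Parabolicity.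
Variables (R : realType) (n : nat) (M : riemannian R n).

(* [christoffel c x k i j] is the symbol with upper index [k]. *)
Definition christoffel (c : chart R M n) (x : 'rV[R]_n) (k i j : 'I_n) : R :=
  2^-1 * \sum_(l < n) invmx (metric c x) k l *
    (partial i (fun y => metric c y j l) x
     + partial j (fun y => metric c y i l) x
     - partial l (fun y => metric c y i j) x).

Definition hessian (c : chart R M n) (u : M -> R) (x : 'rV[R]_n) : 'M[R]_n :=
  \matrix_(i, j) (partial i (partial j (fun y => u (cinv c y))) x
    - \sum_(k < n) christoffel c x k i j * partial k (fun y => u (cinv c y)) x).

Definition laplacian (u : M -> R) (p : M) : R :=
  let c := chart_at p in
  \tr (invmx (metric c (c p)) *m hessian c u (c p)).

(* For merely continuous [u], the inequality [0 <= laplacian u] is understood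
   in the viscosity sense: it holds for every C^2 function touching [u] from
   above. *)
Definition subharmonic (u : M -> R) : Prop :=
  forall (p : M) (U : set M) (phi : M -> R), open U -> U p ->
    C_on 2 U phi -> phi p = u p -> (forall q, U q -> u q <= phi q) ->
    0 <= laplacian phi p.

Definition parabolic : Prop :=
  forall u : M -> R, continuous u -> subharmonic u ->
    (exists B : R, forall p, u p <= B) -> forall p q, u p = u q.

End Parabolicity.

Section Immersions.
Variables (R : realType) (n N : nat) (M : riemannian R n).
Variable (X : M -> 'rV[R]_N).

Definition diff_at (p : M) : 'M[R]_(n, N) :=
  diff_mx (chart_at p) X (chart_at p p).

Definition immersion : Prop :=
  smooth_map X /\ forall p, row_free (diff_at p).

Definition isometric_immersion : Prop :=
  immersion /\
  forall c : chart R M n, atlas c -> forall x, ccodom c x -> forall i j,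
    metric c x i j = dot (row i (diff_mx c X x)) (row j (diff_mx c X x)).

(* Component of [v] orthogonal to the tangent space dX(T_p M), which is the row
   space of [J := diff_at p]; the orthogonal projection onto the latter is
   [v |-> v *m J^T *m (J *m J^T)^-1 *m J]. *)
Definition normal_part (p : M) (v : 'rV[R]_N) : 'rV[R]_N :=
  let J := diff_at p in v - v *m J^T *m invmx (J *m J^T) *m J.

Definition second_diff (p : M) (i j : 'I_n) : 'rV[R]_N :=
  let c := chart_at p in
  \row_k partial i (partial j (fun y => X (cinv c y) 0 k)) (c p).

Definition metric_trace (p : M) (A : 'I_n -> 'I_n -> 'rV[R]_N) : 'rV[R]_N :=
  let G := invmx (metric (chart_at p) (chart_at p p)) in
  \sum_(i < n) \sum_(j < n) G i j *: A i j.

Definition second_form (p : M) (i j : 'I_n) : 'rV[R]_N :=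
  normal_part p (second_diff p i j).

Definition mean_curvature (p : M) : 'rV[R]_N :=
  metric_trace p (second_form p).

Definition self_shrinker (lambda : R) : Prop :=
  [/\ complete_riemannian M, isometric_immersion, 0 < lambda &
      forall p, mean_curvature p = - lambda *: normal_part p (X p)].

(* Orthogonal projection onto the tangent space at [y] of the sphere centred
   at 0 through [y]; it maps the Euclidean connection to the Levi-Civita
   connection of that sphere. *)
Definition sphere_tangent_part (y v : 'rV[R]_N) : 'rV[R]_N :=
  v - (dot v y / dot y y) *: y.

Definition sphere_second_form (p : M) (i j : 'I_n) : 'rV[R]_N :=
  normal_part p (sphere_tangent_part (X p) (second_diff p i j)).

Definition sphere_mean_curvature (p : M) : 'rV[R]_N :=
  metric_trace p (sphere_second_form p).

Definition minimal_immersion_in_sphere (r : R) : Prop :=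
  [/\ forall p, esphere r (X p), isometric_immersion &
      forall p, sphere_mean_curvature p = 0].

End Immersions.

(* Main.v *)
Require Import Defs.
From mathcomp Require Import ring lra.

(* With [u = |X|^2], the identity [Delta X = H] gives
   [Delta u = 2 n + 2 <H, X> = 2 (n - lambda |X^perp|^2)], which is nonnegative
   as soon as [|X|^2 <= n / lambda] everywhere.  Then [u] is bounded and
   subharmonic, hence constant by parabolicity, so that [Delta u = 0] forces
   [|X^perp|^2 = |X|^2 = n / lambda].  Thus [X] is normal, [H = - lambda X] is
   radial, and its component tangent to the sphere vanishes.  Subharmonicity in
   the viscosity sense follows from the second derivative test, the inverse
   metric being a Gram matrix. *)

Set Implicit Arguments.
Unset Strict Implicit.
Unset Printing Implicit Defensive.

Local Open Scope classical_set_scope.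
Local Open Scope ring_scope.

(** * Directional derivatives *)

Section DirectionalDerivative.
Context {R : realType} {V : normedModType R}.
Implicit Types (f : V -> R) (x y v w : V) (a b h t : R).

Lemma is_derive_line f x v t :
  derivable f (x + t *: v) v ->
  is_derive t 1 (fun s => f (x + s *: v)) ('D_v f (x + t *: v)).
Proof.
move=> df.
have E : (fun h => h^-1 *: (((fun s => f (x + s *: v)) \o shift t) (h *: 1) -
          f (x + t *: v))) =
         (fun h => h^-1 *: ((f \o shift (x + t *: v)) (h *: v) -
          f (x + t *: v))).
  apply/funext => h /=; congr (_ *: (f _ - _)).
  by rewrite [h *: 1]mulr1 scalerDl addrCA.
by split; rewrite /derivable /derive E.
Qed.

(** Parametrising the segment by [[0, 1]] instead of [[0, h]] avoids any case distinction on the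
    sign of [h]; the factor [h] comes from the chain rule. *)
Lemma MVT_line f x v h :
  (forall t, 0 <= t <= 1 -> derivable f (x + (t * h) *: v) v) ->
  exists2 t, 0 < t < 1 & f (x + h *: v) - f x = h * 'D_v f (x + (t * h) *: v).
Proof.
move=> df.
pose g := (fun s => f (x + s *: v)) \o ( *%R^~ h).
have dg t : 0 <= t <= 1 -> is_derive t 1 g (h * 'D_v f (x + (t * h) *: v)).
  move=> t01; have d1 := is_derive_line (df t t01).
  have d2 : is_derive t 1 ( *%R^~ h : R -> R) h.
    rewrite (_ : *%R^~ h = id * cst h)//; apply: is_derive_eq.
    by rewrite scaler0 add0r [_ *: _]mulr1.
  split.
    apply/derivable1_diffP/differentiable_comp; apply/derivable1_diffP.
      exact: ex_derive.
    exact: ex_derive.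
  rewrite -derive1E derive1_comp ?derive1E; [|exact: ex_derive..].
  by rewrite !derive_val mulrC.
have [||t tI] := @MVT R g (fun t => h * 'D_v f (x + (t * h) *: v)) 0 1 ltr01.
- by move=> t /[!in_itv]/= /andP[t0 t1]; apply: dg; rewrite !ltW.
- apply: derivable_within_continuous => t /[!in_itv]/= tI.
  by have [] := dg t tI.
- rewrite /g /= mul1r mul0r scale0r addr0 subr0 mulr1 => ->.
  by exists t => //; move: tI; rewrite in_itv.
Qed.

(** The bound on [h] is uniform in [s] and [t], so a local property holds at the intermediate points
    produced by the mean value theorem, whose position is unknown. *)
Lemma near_parallelogram x v w (P : set V) :
  (\forall y \near x, P y) ->
  \forall h \near (0 : R), forall s t : R, `|s| <= 1 -> `|t| <= 1 ->
    P (x + (s * h) *: v + (t * h) *: w).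
Proof.
move=> /nbhs_normP[r /= r0 rP].
have K0 : 0 < `|v| + `|w| + 1 by rewrite ltr_wpDl// addr_ge0.
near=> h => s t s1 t1; apply: rP.
rewrite /= -addrA opprD addrA subrr sub0r normrN.
(* The displacement has norm at most [|h| (|v| + |w|)]; the extra 1 keeps the divisor positive when
   [v = w = 0]. *)
have hr : `|h| * (`|v| + `|w| + 1) < r.
  rewrite -ltr_pdivlMr//; near: h; apply: (@nbhs0_lt R R^o); exact: divr_gt0.
apply: le_lt_trans hr.
rewrite (le_trans (ler_normD _ _))// !normrZ mulrDr mulr1 mulrDr.
by rewrite ler_wpDr// lerD// ler_wpM2r// ler_piMl.
Unshelve. all: by end_near. Qed.

(** The increment is split into a leg along [w] and a leg along [a *: v]. The first quotient tends
    to [d] by hypothesis; by the mean value theorem the second is [a] times a value of ['D_v f] near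
    [x], and continuity gives its limit. *)
Lemma is_derive_addv f x w v a d :
  is_derive x w f d -> (\forall y \near x, derivable f y v) ->
  {for x, continuous ('D_v f)} ->
  is_derive x (w + a *: v) f (d + a * 'D_v f x).
Proof.
move=> [df dfd] dv cv.
suff L : (h^-1 *: ((f \o shift x) (h *: (w + a *: v)) - f x)) @[h --> 0^'] -->
    d + a * 'D_v f x.
  by split; [apply/cvg_ex; exists (d + a * 'D_v f x)|exact: cvg_lim L].
(* Difference quotient of the second leg, starting at the end of the first. *)
pose q2 h := h^-1 * (f (h *: w + x + (h * a) *: v) - f (h *: w + x)).
have -> : (fun h => h^-1 *: ((f \o shift x) (h *: (w + a *: v)) - f x)) =
   (fun h => h^-1 *: ((f \o shift x) (h *: w) - f x)) \+ q2.
  apply/funext => h /=; rewrite /q2 -[h^-1 * _]/(h^-1 *: _) -scalerDr.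
  rewrite [in RHS]addrC [in RHS]addrA [in RHS]subrK; congr (_ *: (f _ - _)).
  by rewrite scalerDr scalerA addrAC.
apply: cvgD; first by rewrite -dfd; exact: df.
apply/cvgrPdist_le => e e0.
(* The final error is [|a|] times this tolerance, hence at most [e], also when [a = 0]. *)
have e1 : 0 < e / (`|a| + 1) by rewrite divr_gt0// ltr_wpDl.
have {}cv : \forall y \near x, `|'D_v f x - 'D_v f y| <= e / (`|a| + 1).
  by move/cvgrPdist_le : cv; apply.
pose good y := derivable f y v /\ `|'D_v f x - 'D_v f y| <= e / (`|a| + 1).
have H : \forall h \near (0 : R)^', forall s t : R, `|s| <= 1 -> `|t| <= 1 ->
    good (x + (s * h) *: w + (t * h) *: (a *: v)).
  by apply: nbhs_dnbhs; apply: near_parallelogram; exact: filterI.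
near=> h.
have h0 : h != 0 by near: h; exact: nbhs_dnbhs_neq.
have Hh t : 0 <= t <= 1 -> good (h *: w + x + (t * (h * a)) *: v).
  move=> /andP[t0 t1].
  have -> : h *: w + x + (t * (h * a)) *: v =
      x + (1 * h) *: w + (t * h) *: (a *: v).
    by rewrite mul1r mulrA scalerA [h *: w + x]addrC.
  suff G : forall s t : R, `|s| <= 1 -> `|t| <= 1 ->
      good (x + (s * h) *: w + (t * h) *: (a *: v)).
    by apply: G; rewrite ?normr1// ger0_norm.
  by near: h.
have [|t /andP[t0 t1] E] := @MVT_line f (h *: w + x) v (h * a).
  by move=> t /Hh[].
rewrite /q2 E mulrA mulKf// -mulrBr normrM.
have [|_ Ht] := Hh t; first by rewrite !ltW.
rewrite (le_trans (ler_wpM2l _ Ht))// mulrCA ler_piMr ?ltW//.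
by rewrite ltr_pdivrMr ?mul1r ?ltrDl// ltr_wpDl.
Unshelve. all: by end_near. Qed.

Lemma is_derive_comp_shift f x v c :
  derivable f (x + c) v -> is_derive x v (f \o shift c) ('D_v f (x + c)).
Proof.
have E : (fun h => h^-1 *: (((f \o shift c) \o shift x) (h *: v) - f (x + c))) =
         (fun h => h^-1 *: ((f \o shift (x + c)) (h *: v) - f (x + c))).
  by apply/funext => h /=; rewrite addrA.
by move=> df; split; rewrite /derivable /derive E.
Qed.

(** The mean value theorem is applied twice: along [v] to the difference [g] of [f] and its
    translate by [h *: w], then along [w] to ['D_v f]. *)
Lemma mixed_increment f x v w h :
  (forall s t, 0 <= s <= 1 -> 0 <= t <= 1 ->
     let y := x + (s * h) *: v + (t * h) *: w in
     derivable f y v /\ derivable ('D_v f) y w) ->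
  exists s t, [/\ 0 <= s <= 1, 0 <= t <= 1 &
    f (x + h *: v + h *: w) - f (x + h *: v) - (f (x + h *: w) - f x) =
    h * (h * 'D_w ('D_v f) (x + (s * h) *: v + (t * h) *: w))].
Proof.
move=> H; pose g := f \o shift (h *: w) - f.
have I0 : 0 <= (0 : R) <= 1 by rewrite lexx ler01.
have I1 : 0 <= (1 : R) <= 1 by rewrite lexx ler01.
have dg s : 0 <= s <= 1 -> is_derive (x + (s * h) *: v) v g
    ('D_v f (x + (s * h) *: v + h *: w) - 'D_v f (x + (s * h) *: v)).
  move=> sI; apply: is_deriveB; first apply: is_derive_comp_shift.
    by have [] := H s 1 sI I1; rewrite mul1r.
  by apply: derivableP; have [] := H s 0 sI I0; rewrite mul0r scale0r addr0.
have [s sI|s /andP[s0 s1] E] := @MVT_line g x v h.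
  by have [] := dg s sI.
have sI : 0 <= s <= 1 by rewrite !ltW.
have [t tI|t /andP[t0 t1] E'] := @MVT_line ('D_v f) (x + (s * h) *: v) w h.
  by have [] := H s t sI tI.
exists s, t; split => //; first by rewrite !ltW.
rewrite -E'; case: (dg s sI) => _ <-; rewrite -E.
by rewrite /g /=.
Qed.

(* Both mixed derivatives are limits of the same second-order increment. *)
Lemma derive_swap f x v w :
  (\forall y \near x, derivable f y v) ->
  (\forall y \near x, derivable f y w) ->
  (\forall y \near x, derivable ('D_v f) y w) ->
  (\forall y \near x, derivable ('D_w f) y v) ->
  {for x, continuous ('D_w ('D_v f))} -> {for x, continuous ('D_v ('D_w f))} ->
  'D_w ('D_v f) x = 'D_v ('D_w f) x.
Proof.
move=> dv dw dvw dwv cvw cwv; apply/eqP; rewrite -subr_eq0 -normr_le0.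
apply/ler_addgt0Pr => e e0; rewrite add0r.
have e2 : 0 < e / 2 by rewrite divr_gt0.
have {}cvw : \forall y \near x, `|'D_w ('D_v f) x - 'D_w ('D_v f) y| <= e / 2.
  by move/cvgrPdist_le : cvw; apply.
have {}cwv : \forall y \near x, `|'D_v ('D_w f) x - 'D_v ('D_w f) y| <= e / 2.
  by move/cvgrPdist_le : cwv; apply.
pose good y := ((derivable f y v /\ derivable ('D_v f) y w) /\
  (derivable f y w /\ derivable ('D_w f) y v)) /\
  (`|'D_w ('D_v f) x - 'D_w ('D_v f) y| <= e / 2 /\
   `|'D_v ('D_w f) x - 'D_v ('D_w f) y| <= e / 2).
have H : \forall h \near (0 : R)^', forall s t : R, `|s| <= 1 -> `|t| <= 1 ->
    good (x + (s * h) *: v + (t * h) *: w).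
  apply: nbhs_dnbhs; apply: near_parallelogram.
  exact: filterI (filterI (filterI dv dvw) (filterI dw dwv)) (filterI cvw cwv).
near (0 : R)^' => h.
have h0 : h != 0 by near: h; exact: nbhs_dnbhs_neq.
have Hh s t : 0 <= s <= 1 -> 0 <= t <= 1 ->
    good (x + (s * h) *: v + (t * h) *: w).
  move=> /andP[s0 s1] /andP[t0 t1].
  suff G : forall s t : R, `|s| <= 1 -> `|t| <= 1 ->
      good (x + (s * h) *: v + (t * h) *: w).
    by apply: G; rewrite ger0_norm.
  by near: h.
have [s1 t1 sI tI|s1 [t1 [s1I t1I E1]]] := @mixed_increment f x v w h.
  by have [[dy _] _] := Hh _ _ sI tI; exact: dy.
have [s2 t2 sI tI|s2 [t2 [s2I t2I E2]]] := @mixed_increment f x w v h.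
  by have [[_ dy] _] := Hh _ _ tI sI; rewrite addrAC; exact: dy.
have [_ [C1 _]] := Hh _ _ s1I t1I.
have [_ [_]] := Hh _ _ t2I s2I; rewrite addrAC => C2.
move: C1 C2 E1 E2; move: ('D_w ('D_v f) x) ('D_v ('D_w f) x) => A B.
move: ('D_w ('D_v f) _) ('D_v ('D_w f) _) => A' B' C1 C2 E1 E2.
(* Exchanging [v] and [w] only reorders the terms of the increment, so the two formulas agree and
   the nonzero factor [h] cancels twice. *)
have E : A' = B'.
  apply/(mulfI h0)/(mulfI h0); rewrite -E1 -E2 [x + h *: w + _]addrAC; ring.
rewrite (_ : A - B = (A - A') + (B' - B)); last by rewrite E addrA subrK.
by rewrite (le_trans (ler_normD _ _))// [leRHS]splitr lerD// distrC.
Unshelve. all: by end_near. Qed.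

(** An interior minimum along the line kills the first derivative. If the second were negative,
    ['D_v f] would be negative just past [x], and the mean value theorem would give a value of [f]
    below [f x]. *)
Lemma second_derive_test f x v :
  (\forall y \near x, derivable f y v) -> derivable ('D_v f) x v ->
  (\forall y \near x, f x <= f y) ->
  'D_v f x = 0 /\ 0 <= 'D_v ('D_v f) x.
Proof.
move=> dv dvv fmin.
have [r r0 rP] : exists2 r : R, 0 < r & forall t, `|t| < r ->
    derivable f (x + t *: v) v /\ f x <= f (x + t *: v).
  pose good y := derivable f y v /\ f x <= f y.
  (* A degenerate parallelogram: with [s = 1] and [t = 0] only the segment along [v] remains. *)
  have /nbhs_normP[r /= r0 rP] : \forall h \near (0 : R), forall s t : R,
      `|s| <= 1 -> `|t| <= 1 -> good (x + (s * h) *: v + (t * h) *: v).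
    by apply: near_parallelogram; exact: filterI.
  exists r => // t tr; have := rP t; rewrite /= sub0r normrN => /(_ tr 1 0).
  by rewrite mul1r mul0r scale0r addr0 normr1 normr0; apply.
have x0 : x + (0 : R) *: v = x by rewrite scale0r addr0.
have D0 : 'D_v f x = 0.
  have g' t : `|t| < r ->
      is_derive t 1 (fun s => f (x + s *: v)) ('D_v f (x + t *: v)).
    by move=> /rP[df _]; exact: is_derive_line.
  have [||||] := @derive1_at_min R (fun s => f (x + s *: v)) (- r) r 0.
  - by rewrite ge0_cp// ltW.
  - by move=> t /[!in_itv]/= tr; have [] := g' t; rewrite ?ltr_norml.
  - by rewrite in_itv/= oppr_lt0 r0.
  - move=> t /[!in_itv]/= tr; rewrite x0.
    by have [] := rP t; rewrite ?ltr_norml.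
  - by move=> _ <-; have [|_] := g' 0; rewrite ?normr0// x0 => ->.
split => //; rewrite leNgt; apply/negP => D2.
have : \forall h \near (0 : R)^',
    h^-1 *: (('D_v f \o shift x) (h *: v) - 'D_v f x) < 0.
  by have := cvgr_lt _ dvv; apply.
move=> /nbhs_normP[r' /= r'0 r'P].
(* Strictly below [r], where [f] is derivable along [v] and minimal at [x], and below [r'], where
   the quotient of ['D_v f] is negative. *)
pose h := Num.min r r' / 2.
have m0 : 0 < Num.min r r' by rewrite lt_min r0 r'0.
have h0 : 0 < h by rewrite divr_gt0.
have hm : h < Num.min r r' by rewrite ltr_pdivrMr// mulr_natr mulr2n ltrDl.
move: hm; rewrite lt_min => /andP[hr hr'].
have [t /andP[t0 t1]|t /andP[t0 t1]] := @MVT_line f x v h.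
  have [] := rP (t * h) => //.
  by rewrite ger0_norm ?(mulr_ge0 t0 (ltW h0))// (le_lt_trans _ hr)// ger_pMl.
have th0 : 0 < t * h by rewrite mulr_gt0.
have thr' : t * h < r' by rewrite (lt_trans _ hr')// gtr_pMl.
have := r'P (t * h).
rewrite /= sub0r normrN gtr0_norm// gt_eqF// D0 subr0 addrC.
move=> /(_ thr' isT); rewrite pmulr_rlt0 ?invr_gt0// => Dt E.
have : f (x + h *: v) - f x < 0 by rewrite E pmulr_rlt0.
rewrite subr_lt0 ltNge => /negP; apply.
by have [] := rP h => //; rewrite gtr0_norm.
Qed.

End DirectionalDerivative.

(** * Functions of class C^k *)

Section ClassC.
Context {R : realType} {n : nat}.
Implicit Types (f g : 'rV[R]_n -> R) (U V : set 'rV[R]_n) (x v : 'rV[R]_n).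

Lemma class_CS k U f : class_C k.+1 U f -> class_C k U f.
Proof.
elim: k f => [|k IH] f [cf df]; first by split.
by split=> // i; have [? /IH ?] := df i.
Qed.

Lemma class_C_subset k U V f : V `<=` U -> class_C k U f -> class_C k V f.
Proof.
move=> VU; elim: k f => [|k IH] f [cf df].
  by split=> // x /VU; exact: cf.
split=> [x /VU|i]; first exact: cf.
have [dfi /IH Cfi] := df i; split=> // x /VU; exact: dfi.
Qed.

Lemma near_eq_continuous f g x :
  {near x, f =1 g} -> {for x, continuous f} -> {for x, continuous g}.
Proof.
move=> fg; rewrite /prop_for /continuous_at -(nbhs_singleton fg).
apply: cvg_trans.
exact: (near_eq_cvg fg).
Qed.

Lemma open_near_eq U f g x : open U -> U x -> {in U, f =1 g} ->
  {near x, f =1 g}.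
Proof.
move=> oU Ux fg; have nU := open_nbhs_nbhs (conj oU Ux).
by apply: filterS nU => y Uy; apply: fg; rewrite inE.
Qed.

(** Openness turns equality on [U] into equality near each of its points, which passes to partial
    derivatives. The closure properties below rely on this, since their differentiation rules are
    available only on [U]. *)
Lemma class_C_ext k U f g : open U -> {in U, f =1 g} ->
  class_C k U f -> class_C k U g.
Proof.
move=> oU; elim: k f g => [|k IH] f g fg [cf df].
  split=> // x Ux.
  exact: near_eq_continuous (open_near_eq oU Ux fg) (cf x Ux).
split=> [x Ux|i].
  exact: near_eq_continuous (open_near_eq oU Ux fg) (cf x Ux).
have [dfi cfi] := df i; split=> [x Ux|].
  exact: near_eq_derivable (open_near_eq oU Ux fg) (dfi x Ux).
apply: IH cfi => x /[1!inE] Ux; exact: near_eq_derive (open_near_eq oU Ux fg).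
Qed.

Lemma class_C_cst k U (a : R) : open U -> class_C k U (cst a).
Proof.
move=> oU; elim: k a => [|k IH] a.
  by split=> // x _; exact: cst_continuous.
split=> [x _|i]; first exact: cst_continuous.
split=> [x _|]; first exact: derivable_cst.
by apply: (class_C_ext oU _ (IH 0)) => x _; rewrite /partial derive_cst.
Qed.

Lemma class_CD k U f g : open U ->
  class_C k U f -> class_C k U g -> class_C k U (f + g).
Proof.
move=> oU; elim: k f g => [|k IH] f g [cf df] [cg dg].
  by split=> // x Ux; apply: continuousD; [exact: cf|exact: cg].
split=> [x Ux|i]; first by apply: continuousD; [exact: cf|exact: cg].
have [dfi cfi] := df i; have [dgi cgi] := dg i.
split=> [x Ux|]; first by apply: derivableD; [exact: dfi|exact: dgi].
apply: (class_C_ext oU _ (IH _ _ cfi cgi)) => x /[1!inE] Ux.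
by rewrite /partial deriveD//; [exact: dfi|exact: dgi].
Qed.

Lemma class_CM k U f g : open U ->
  class_C k U f -> class_C k U g -> class_C k U (f * g).
Proof.
move=> oU; elim: k f g => [|k IH] f g Cf Cg.
  have [[cf _] [cg _]] := (Cf, Cg).
  by split=> // x Ux; apply: continuousM; [exact: cf|exact: cg].
have [[cf df] [cg dg]] := (Cf, Cg).
split=> [x Ux|i]; first by apply: continuousM; [exact: cf|exact: cg].
have [dfi cfi] := df i; have [dgi cgi] := dg i.
split=> [x Ux|]; first by apply: derivableM; [exact: dfi|exact: dgi].
apply: (class_C_ext oU _ (class_CD oU (IH _ _ (class_CS Cf) cgi)
  (IH _ _ (class_CS Cg) cfi))) => x /[1!inE] Ux.
by rewrite /partial deriveM//; [exact: dfi|exact: dgi].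
Qed.

Lemma class_CB k U f g : open U ->
  class_C k U f -> class_C k U g -> class_C k U (f - g).
Proof.
move=> oU Cf Cg.
have -> : - g = cst (- 1) * g by apply/funext => x; rewrite /= mulN1r.
apply: class_CD => //.
by apply: class_CM => //; exact: class_C_cst.
Qed.

Lemma class_C_sum k U (I : Type) (r : seq I) (F : I -> 'rV[R]_n -> R) :
  open U -> (forall i, class_C k U (F i)) -> class_C k U (\sum_(i <- r) F i).
Proof.
move=> oU CF; elim/big_ind: _ => // [|f g]; last exact: class_CD.
exact: class_C_cst.
Qed.

(** The vector [v] is built up one coordinate at a time, each step being an instance of
    [is_derive_addv]. *)
Lemma is_derive_partial U f x v : open U -> U x -> class_C 1 U f ->
  is_derive x v f (\sum_(i < n) v 0 i * partial i f x).
Proof.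
move=> oU Ux [_ Cf]; have nU := open_nbhs_nbhs (conj oU Ux).
rewrite [X in is_derive _ X](row_sum_delta v).
elim/big_rec2: _ => [|i d w _ IH]; first exact: is_derive0.
have [df [cdf _]] := Cf i; rewrite addrC [X in is_derive _ _ _ X]addrC.
apply: is_derive_addv => //; last exact: cdf.
by apply: filterS nU.
Qed.

Lemma partialC U f x i j : open U -> U x -> class_C 2 U f ->
  partial i (partial j f) x = partial j (partial i f) x.
Proof.
move=> oU Ux [_ Cf]; have nU := open_nbhs_nbhs (conj oU Ux).
have [dfi [_ ddfi]] := Cf i; have [dfj [_ ddfj]] := Cf j.
have [dji [cji _]] := ddfi j; have [dij [cij _]] := ddfj i.
have near_of (P : set 'rV[R]_n) : (forall y, U y -> P y) ->
    \forall y \near x, P y.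
  by move=> UP; apply: filterS nU.
apply: (@derive_swap _ _ f x (delta_mx 0 j) (delta_mx 0 i)).
- exact: near_of dfj.
- exact: near_of dfi.
- exact: near_of dij.
- exact: near_of dji.
- exact: cij.
- exact: cji.
Qed.

(** Near [x] the derivative along [v] is the combination [g v] of the partial derivatives;
    differentiating it along [v] again gives the quadratic form of second derivatives, to which
    [second_derive_test] applies. *)
Lemma hessian_local_min U f x : open U -> U x -> class_C 2 U f ->
  (forall y, U y -> f x <= f y) ->
  (forall i, partial i f x = 0) /\
  forall v, 0 <= \sum_(j < n) v 0 j *
    \sum_(i < n) v 0 i * partial i (partial j f) x.
Proof.
move=> oU Ux Cf fmin; have nU := open_nbhs_nbhs (conj oU Ux).
have Cf1 := class_CS Cf.
have D1 v y : U y -> is_derive y v f (\sum_(i < n) v 0 i * partial i f y).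
  by move=> Uy; exact: is_derive_partial Uy Cf1.
pose g v := \sum_(j < n) v 0 j *: partial j f.
have gE v : \forall y \near x, g v y = 'D_v f y.
  apply: filterS nU => y Uy; have [_ ->] := D1 v y Uy.
  by rewrite /g fct_sumE.
have D2 v : is_derive x v (g v)
    (\sum_(j < n) v 0 j * \sum_(i < n) v 0 i * partial i (partial j f) x).
  apply: is_derive_sum => j; apply: is_deriveZ.
  by apply: is_derive_partial Ux _ => //; have [_ /(_ j)[]] := Cf.
have test v : 'D_v f x = 0 /\ 0 <= 'D_v ('D_v f) x.
  apply: second_derive_test.
  - by apply: filterS nU => y /(D1 v)[].
  - by have [] := near_eq_is_derive (gE v) (D2 v).
  - exact: filterS nU.
split=> [i|v]; first by have [] := test (delta_mx 0 i).
have [_] := test v.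
by have [_ ->] := near_eq_is_derive (gE v) (D2 v).
Qed.

End ClassC.

(** * The Laplacian of the squared norm of an isometric immersion *)

Section Dot.
Context {R : realType} {N : nat}.
Implicit Types (u v w : 'rV[R]_N) (a : R).

Lemma dotE u v : dot u v = (u *m v^T) 0 0.
Proof. by rewrite mxE; apply: eq_bigr => k _; rewrite mxE. Qed.

Lemma dotC u v : dot u v = dot v u.
Proof. by apply: eq_bigr => k _; rewrite mulrC. Qed.

Lemma dotBl u v w : dot (u - v) w = dot u w - dot v w.
Proof. by rewrite !dotE mulmxBl !mxE. Qed.

Lemma dotZl a u w : dot (a *: u) w = a * dot u w.
Proof. by rewrite !dotE -scalemxAl !mxE. Qed.

Lemma dot_suml I (r : seq I) (F : I -> 'rV[R]_N) w :
  dot (\sum_(i <- r) F i) w = \sum_(i <- r) dot (F i) w.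
Proof.
by rewrite dotE mulmx_suml summxE; apply: eq_bigr => i _; rewrite dotE.
Qed.

Lemma dot_ge0 u : 0 <= dot u u.
Proof. by apply: sumr_ge0 => k _; rewrite -expr2 sqr_ge0. Qed.

Lemma dot_eq0 u : dot u u = 0 -> u = 0.
Proof.
move=> /eqP; rewrite psumr_eq0; last by move=> k _; rewrite -expr2 sqr_ge0.
move=> /allP u0; apply/rowP => k; rewrite mxE.
by have := u0 k (mem_index_enum k); rewrite -expr2 sqrf_eq0 => /eqP.
Qed.

End Dot.

Lemma dot_mulmx (R : realType) m N (u : 'rV[R]_m) (A : 'M[R]_(m, N)) v :
  dot (u *m A) v = dot u (v *m A^T).
Proof. by rewrite !dotE trmx_mul trmxK mulmxA. Qed.

Lemma mul_trmx_row (R : realType) m N (u : 'rV[R]_N) (A : 'M[R]_(m, N)) i :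
  (u *m A^T) 0 i = dot u (row i A).
Proof. by rewrite mxE; apply: eq_bigr => k _; rewrite !mxE. Qed.

(** If [v] is killed by [J *m J^T], then [v *m J] has squared norm zero, so [v = 0] because the rows
    of [J] are independent. *)
Lemma gram_unitmx (R : realType) m N (J : 'M[R]_(m, N)) :
  row_free J -> J *m J^T \in unitmx.
Proof.
move=> Jf; rewrite -row_free_unit; apply: inj_row_free => v.
rewrite mulmxA => vJ0; apply: (row_free_inj Jf); rewrite mul0mx.
by apply: dot_eq0; rewrite dot_mulmx vJ0 dotE trmx0 mulmx0 mxE.
Qed.

(** By cyclicity the trace is the sum of the values of the quadratic form of [Q] on the columns of
    [B]. *)
Lemma mxtrace_gram_ge0 (R : realType) m N (B : 'M[R]_(m, N)) (Q : 'M[R]_m) :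
  (forall v : 'rV[R]_m, 0 <= dot (v *m Q) v) -> 0 <= \tr (B *m B^T *m Q).
Proof.
move=> Qpos; rewrite -mulmxA mxtrace_mulC; apply: sumr_ge0 => k _.
have := Qpos (row k B^T); rewrite dotE -row_mul tr_row trmxK.
rewrite (_ : (row k _ *m col k B) 0 0 = (B^T *m Q *m B) k k)//.
by rewrite [LHS]mxE [RHS]mxE; apply: eq_bigr => i _; rewrite !mxE.
Qed.

(** * Orthogonal projection onto the row space of a matrix *)

Section TangentProjection.
Context {R : realType} {n N : nat} (J : 'M[R]_(n, N)).

Definition tangent_projection : 'M[R]_N := J^T *m invmx (J *m J^T) *m J.

Let P := tangent_projection.

Lemma trmx_invgram : (invmx (J *m J^T))^T = invmx (J *m J^T).
Proof. by rewrite trmx_inv trmx_mul trmxK. Qed.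

Lemma tangent_projection_sym : P^T = P.
Proof.
by rewrite /P /tangent_projection !trmx_mul trmxK trmx_invgram mulmxA.
Qed.

Lemma tangent_projectionK : row_free J -> P *m P = P.
Proof.
move=> Jf; rewrite /P /tangent_projection !mulmxA -(mulmxA _ J J^T).
by rewrite mulmxKV// gram_unitmx.
Qed.

Lemma dot_tangent_projection u v : row_free J ->
  dot (u *m P) v = dot (u *m P) (v *m P).
Proof.
move=> Jf; rewrite [RHS]dotC [in RHS]dot_mulmx tangent_projection_sym -mulmxA.
by rewrite tangent_projectionK// dotC.
Qed.

(** This coordinate form is the one that can be matched with the Christoffel term of the Hessian. *)
Lemma dot_tangent_projectionE u v :
  dot (u *m P) v = \sum_(k < n)
    (\sum_(l < n) invmx (J *m J^T) k l * dot u (row l J)) * dot v (row k J).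
Proof.
rewrite /P /tangent_projection !mulmxA dot_mulmx; apply: eq_bigr => k _.
rewrite mul_trmx_row; congr (_ * _); rewrite mxE; apply: eq_bigr => l _.
by rewrite mul_trmx_row mulrC -[in LHS]trmx_invgram mxE.
Qed.

End TangentProjection.

Lemma partial_sum_mul (R : realType) n N (A B : 'I_N -> 'rV[R]_n -> R)
    (i : 'I_n) x :
  (forall k, derivable (A k) x (delta_mx 0 i)) ->
  (forall k, derivable (B k) x (delta_mx 0 i)) ->
  partial i (fun y => \sum_(k < N) A k y * B k y) x =
  \sum_(k < N) (A k x * partial i (B k) x + B k x * partial i (A k) x).
Proof.
move=> dA dB.
have -> : (fun y => \sum_(k < N) A k y * B k y) = \sum_(k < N) (A k * B k).
  by apply/funext => y; rewrite fct_sumE.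
rewrite /partial derive_sum => [|k]; last exact: derivableM.
by apply: eq_bigr => k _; rewrite deriveM.
Qed.

Lemma near_eq_partial (R : realType) n (i : 'I_n) (f g : 'rV[R]_n -> R) x :
  (\forall y \near x, f y = g y) -> partial i f x = partial i g x.
Proof. exact: near_eq_derive. Qed.

(* The bracketed sums are the partial derivatives of the metric induced by an
   immersion with differential [J] and second derivatives [S]. *)
Lemma first_kind_christoffel (R : realType) n N (S : 'I_n -> 'I_n -> 'rV[R]_N)
    (J : 'M[R]_(n, N)) (i j l : 'I_n) :
  (forall a b, S a b = S b a) ->
  2^-1 * ((dot (S i j) (row l J) + dot (S i l) (row j J))
        + (dot (S j i) (row l J) + dot (S j l) (row i J))
        - (dot (S l i) (row j J) + dot (S l j) (row i J))) =
  dot (S i j) (row l J).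
Proof.
by move=> SC; rewrite (SC j i) (SC l i) (SC l j); field.
Qed.

(** * Christoffel symbols, Hessian and Laplacian for the induced metric *)

Section Immersed.
Context {R : realType} {n N : nat} (M : riemannian R n) (X : M -> 'rV[R]_N).
Hypothesis isoX : isometric_immersion X.
Variable p : M.

Let c := chart_at p.
Let x := c p.
Let J := diff_at X p.
Let G := invmx (metric c x).
Let S := second_diff X p.
Let Y k := fun y => X (cinv c y) 0 k.

Let ac : atlas c. Proof. exact: chart_at_atlas. Qed.
Let xU : ccodom c x. Proof. by apply: cmap_codom; exact: chart_at_dom. Qed.
Let oU : open (ccodom c). Proof. exact: ccodom_open. Qed.
Let nU : \forall y \near x, ccodom c y.
Proof. by apply: open_nbhs_nbhs; split. Qed.

Lemma coord_class_C l k : class_C l (ccodom c) (Y k).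
Proof.
have [[sX _] _] := isoX; have := sX l k c ac.
by rewrite (_ : [set _ | _ /\ _] = ccodom c)//; apply/seteqP; split=> y // [].
Qed.

Let dY k y i : ccodom c y -> derivable (Y k) y (delta_mx 0 i).
Proof. by have [_ /(_ i)[d _]] := coord_class_C 1 k; exact: d. Qed.

Let ddY k y i j : ccodom c y ->
  derivable (partial i (Y k)) y (delta_mx 0 j).
Proof.
by have [_ /(_ i)[_ [_ /(_ j)[d _]]]] := coord_class_C 2 k; exact: d.
Qed.

Lemma metric_gram : metric c x = J *m J^T.
Proof.
have [_ gX] := isoX; apply/matrixP => i j; rewrite gX// [RHS]mxE.
by apply: eq_bigr => k _; rewrite !mxE.
Qed.

Lemma diff_free : row_free J.
Proof. by have [[_ fX] _] := isoX; exact: fX. Qed.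

Let SE i j k : S i j 0 k = partial i (partial j (Y k)) x.
Proof. by rewrite /S /second_diff mxE. Qed.

Lemma second_diffC i j : S i j = S j i.
Proof.
apply/rowP => k.
apply: etrans (SE i j k) (etrans _ (esym (SE j i k))).
exact: (partialC i j oU xU (coord_class_C 2 k)).
Qed.

Let JE i k : row i J 0 k = partial i (Y k) x.
Proof. by rewrite /J /diff_at !mxE. Qed.

Let YE k : Y k x = X p 0 k.
Proof. by rewrite /Y cmapK//; exact: chart_at_dom. Qed.

Let dotSX a b : dot (S a b) (X p) =
  \sum_(k < N) partial a (partial b (Y k)) x * Y k x.
Proof. by apply: eq_bigr => k _; congr (_ * _); [exact: SE|exact: esym (YE k)]. Qed.

Let dotXJ j : dot (X p) (row j J) = \sum_(k < N) Y k x * partial j (Y k) x.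
Proof. by apply: eq_bigr => k _; congr (_ * _); [exact: esym (YE k)|exact: JE]. Qed.

Let metricE y i j : ccodom c y ->
  metric c y i j = \sum_(k < N) partial i (Y k) y * partial j (Y k) y.
Proof.
by have [_ gX] := isoX => Uy; rewrite gX//; apply: eq_bigr => k _; rewrite !mxE.
Qed.

Lemma partial_metric l i j :
  partial l (fun y => metric c y i j) x =
  dot (S l i) (row j J) + dot (S l j) (row i J).
Proof.
have nE : \forall y \near x, metric c y i j =
    \sum_(k < N) partial i (Y k) y * partial j (Y k) y.
  by apply: filterS nU => y Uy; exact: metricE.
rewrite (near_eq_partial l nE) partial_sum_mul; [|by move=> k; exact: ddY..].
rewrite /dot -big_split /=; apply: eq_bigr => k _.
have flip (a b d e : R) : a * b + d * e = e * d + b * a by ring.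
apply: etrans (flip _ _ _ _) _.
by congr (_ * _ + _ * _); apply: esym; first [exact: SE|exact: JE].
Qed.

(** The Christoffel symbols are thus the coefficients, in the frame of rows of [J], of the
    tangential part of [S i j]. *)
Lemma christoffelE k i j :
  christoffel c x k i j = \sum_(l < n) G k l * dot (S i j) (row l J).
Proof.
rewrite /christoffel mulr_sumr; apply: eq_bigr => l _.
rewrite mulrCA; congr (_ * _).
apply: etrans (first_kind_christoffel J i j l second_diffC).
by congr (_ * (_ + _ - _)); exact: partial_metric.
Qed.

Definition sqnorm (q : M) : R := dot (X q) (X q).

Let u y := sqnorm (cinv c y).

Lemma partial_sqnorm j y : ccodom c y ->
  partial j u y = \sum_(k < N) (2 * Y k y) * partial j (Y k) y.
Proof.
move=> Uy; rewrite (_ : u = fun y => \sum_(k < N) Y k y * Y k y)//.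
rewrite partial_sum_mul; [|by move=> k; exact: dY..].
by apply: eq_bigr => k _; ring.
Qed.

Lemma partial_sqnorm_at j : partial j u x = 2 * dot (X p) (row j J).
Proof.
rewrite partial_sqnorm//; apply: etrans _ (esym (congr1 ( *%R 2) (dotXJ j))).
by rewrite mulr_sumr; apply: eq_bigr => k _; rewrite mulrA.
Qed.

Lemma partial2_sqnorm i j :
  partial i (partial j u) x = 2 * (metric c x i j + dot (S i j) (X p)).
Proof.
have nE : \forall y \near x, partial j u y =
    \sum_(k < N) (2 \*o Y k) y * partial j (Y k) y.
  by apply: filterS nU => y Uy; rewrite partial_sqnorm.
rewrite (near_eq_partial i nE) partial_sum_mul; last by move=> k; exact: ddY.
  rewrite metricE// dotSX -big_split mulr_sumr; apply: eq_bigr => k _.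
  have -> : partial i (2 \*o Y k) x = 2 * partial i (Y k) x.
    by apply: deriveMl; exact: dY.
  by rewrite /=; ring.
move=> k.
exact: (@derivableM _ _ (cst 2) (Y k) x _ (derivable_cst _ _ _) (dY xU)).
Qed.

Lemma normal_partE v : normal_part X p v = v - v *m tangent_projection J.
Proof. by rewrite /normal_part /tangent_projection !mulmxA. Qed.

Lemma dot_normal_partE v w : dot (normal_part X p v) w = dot v w -
  \sum_(k < n) (\sum_(l < n) G k l * dot v (row l J)) * dot w (row k J).
Proof.
by rewrite normal_partE dotBl dot_tangent_projectionE /G metric_gram.
Qed.

Lemma second_formC i j : second_form X p i j = second_form X p j i.
Proof. exact: (congr1 (normal_part X p) (second_diffC i j)). Qed.

(** Second partial derivatives give the metric plus [dot (S i j) (X p)]; the Christoffel correction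
    subtracts exactly the contribution of the tangential part of [S i j], which leaves the second
    fundamental form. *)
Lemma hessian_sqnorm i j :
  hessian c sqnorm x i j =
  2 * (metric c x i j + dot (second_form X p i j) (X p)).
Proof.
apply: etrans (mxE _ _ _ _) _.
rewrite dot_normal_partE addrA mulrBr.
congr (_ - _); first exact: partial2_sqnorm.
rewrite mulr_sumr; apply: eq_bigr => k _; rewrite mulrCA.
by congr (_ * _); [exact: christoffelE|exact: partial_sqnorm_at].
Qed.

Lemma laplacian_sqnorm :
  laplacian sqnorm p = 2 * (n%:R + dot (mean_curvature X p) (X p)).
Proof.
have -> : n%:R = \tr (invmx (metric c x) *m metric c x).
  by rewrite mulVmx ?mxtrace1// metric_gram gram_unitmx// diff_free.
rewrite /mean_curvature /metric_trace -/c -/x dot_suml.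
rewrite /mxtrace -big_split mulr_sumr.
apply: eq_bigr => i _; rewrite dot_suml [LHS]mxE [(_ *m metric c x) i i]mxE.
rewrite -big_split mulr_sumr; apply: eq_bigr => j _.
(* The trace of the product pairs entry [i j] of the inverse metric with entry [j i] of the Hessian,
   while [metric_trace] uses [i j] twice; symmetry of the second fundamental form reconciles
   them. *)
have H : hessian c sqnorm x j i =
    2 * (metric c x j i + dot (second_form X p i j) (X p)).
  by rewrite hessian_sqnorm second_formC.
by rewrite H dotZl [LHS]mulrCA; congr (_ * _); exact: mulrDr.
Qed.

Lemma normal_part_dot v w :
  dot (normal_part X p v) w = dot v (normal_part X p w).
Proof.
rewrite !normal_partE [RHS]dotC !dotBl dot_mulmx tangent_projection_sym.
by rewrite [dot w v]dotC [dot (w *m _) v]dotC.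
Qed.

Lemma dot_normal_part v : dot (normal_part X p v) v =
  dot v v - dot (v *m tangent_projection J) (v *m tangent_projection J).
Proof. by rewrite normal_partE dotBl dot_tangent_projection// diff_free. Qed.

(** In the chart, [w = phi - sqnorm] has a minimum at [x]. Its gradient vanishes there, so the
    Christoffel terms of the two Hessians agree and their difference [Q] is the positive
    semidefinite matrix of second derivatives of [w]. *)
Lemma laplacian_le phi (U : set M) : open U -> U p -> C_on 2 U phi ->
  phi p = sqnorm p -> (forall q, U q -> sqnorm q <= phi q) ->
  laplacian sqnorm p <= laplacian phi p.
Proof.
move=> oUp Up Cphi phip le_phi.
pose V := [set y | ccodom c y /\ U (cinv c y)].
have oV : open V.
  rewrite openE => y [Uy Vy]; apply: filterI; first exact: open_nbhs_nbhs.
  apply: (cinv_continuous Uy); exact: open_nbhs_nbhs.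
have cx : cinv c x = p by apply: cmapK; exact: chart_at_dom.
have Vx : V x by split=> //; rewrite cx.
pose f y := phi (cinv c y); pose w := f - u.
have Cf : class_C 2 V f by exact: Cphi.
have Cu : class_C 2 V u.
  have -> : u = \sum_(k < N) Y k * Y k by apply/funext => y; rewrite fct_sumE.
  apply: (class_C_sum _ oV) => k.
  have CY : class_C 2 V (Y k).
    by apply: class_C_subset (coord_class_C 2 k) => y [].
  exact: (class_CM oV CY CY).
have Cw : class_C 2 V w by exact: class_CB.
have wmin y : V y -> w x <= w y.
  move=> [Uy Vy]; have -> : w x = 0.
    by rewrite /w /f /u !fctE cx phip subrr.
  by rewrite /w !fctE subr_ge0; exact: le_phi.
have [Dw D2w] := hessian_local_min oV Vx Cw wmin.
have dB (a b : 'rV[R]_n -> R) i y : derivable a y (delta_mx 0 i) ->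
    derivable b y (delta_mx 0 i) ->
    partial i (a - b) y = partial i a y - partial i b y.
  exact: deriveB.
have d1 (a : 'rV[R]_n -> R) i y : class_C 2 V a -> V y ->
    derivable a y (delta_mx 0 i).
  by move=> [_ /(_ i)[d _]]; exact: d.
have dfu i : partial i f x = partial i u x.
  by apply/eqP; rewrite -subr_eq0 -dB ?Dw//; exact: d1.
have d2 i j : partial i (partial j w) x =
    partial i (partial j f) x - partial i (partial j u) x.
  have nE : \forall y \near x, partial j w y = (partial j f - partial j u) y.
    have : \forall y \near x, V y by exact: open_nbhs_nbhs.
    by apply: filterS => y Vy; apply: dB; exact: d1.
  rewrite (near_eq_partial i nE); apply: dB.
    by have [_ /(_ j)[_ [_ /(_ i)[d _]]]] := Cf; exact: d.
  by have [_ /(_ j)[_ [_ /(_ i)[d _]]]] := Cu; exact: d.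
pose Q : 'M[R]_n := \matrix_(i, j) partial i (partial j w) x.
have hessE : hessian c phi x = hessian c sqnorm x + Q.
  apply/matrixP => i j; rewrite mxE [RHS]mxE.
  rewrite [X in _ = X + _]mxE [X in _ = _ + X]mxE d2.
  rewrite (eq_bigr (fun k => christoffel c x k i j * partial k u x)).
    by rewrite -/f -/u; ring.
  by move=> k _; rewrite -/f dfu.
(* Since the metric is [J *m J^T] and [G] is its symmetric inverse, [G] is itself a Gram matrix; no
   matrix square root has to be taken. *)
have GG : G = (G *m J) *m (G *m J)^T.
  rewrite trmx_mul mulmxA -(mulmxA G J) -metric_gram /G trmx_inv metric_sym//.
  by rewrite mulVmx ?mul1mx// metric_gram gram_unitmx// diff_free.
rewrite /laplacian -/c -/x hessE mulmxDr mxtraceD lerDl -/G GG.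
apply: mxtrace_gram_ge0 => v; suff <- : \sum_(j < n) v 0 j *
    (\sum_(i < n) v 0 i * partial i (partial j w) x) = dot (v *m Q) v by [].
apply: eq_bigr => j _; rewrite mulrC; congr (_ * _).
by rewrite mxE; apply: eq_bigr => i _; rewrite mxE.
Qed.

End Immersed.

(** * Self-shrinkers *)

Lemma laplacian_cst (R : realType) n (M : riemannian R n) (a : R) (p : M) :
  laplacian (cst a) p = 0.
Proof.
have p0 (b : R) i y : partial i (cst b) y = 0 :> R by exact: derive_cst.
rewrite /laplacian (_ : hessian _ _ _ = 0) ?mulmx0 ?mxtrace0//.
apply/matrixP => i j; rewrite mxE [RHS]mxE big1 ?subr0 => [|k _].
  rewrite (_ : partial j (fun y => _) = cst 0) ?p0//.
  by apply/funext => y; exact: p0.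
by rewrite [X in _ * X]p0 mulr0.
Qed.

Section SphereImmersion.
Context {R : realType} {n N : nat} (M : riemannian R n) (X : M -> 'rV[R]_N).
Hypothesis isoX : isometric_immersion X.

(** Smoothness is stated in charts, so continuity is obtained for the coordinate expression and
    pulled back along the continuous chart map. *)
Lemma sqnorm_continuous : continuous (sqnorm X).
Proof.
move=> p; pose c := chart_at p.
have ac : atlas c by exact: chart_at_atlas.
have pc : cdom c p by exact: chart_at_dom.
have xU : ccodom c (c p) by exact: cmap_codom.
have oU : open (ccodom c) by exact: ccodom_open.
pose Y k y := X (cinv c y) 0 k.
have [cu _] : class_C 0 (ccodom c) (\sum_(k < N) Y k * Y k).
  apply: (class_C_sum _ oU) => k; have CY := coord_class_C isoX p 0 k.
  exact: (class_CM oU CY CY).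
have nE : \forall q \near p, ((\sum_(k < N) Y k * Y k) \o c) q = sqnorm X q.
  have : \forall q \near p, cdom c q.
    by apply: open_nbhs_nbhs; split => //; exact: cdom_open.
  apply: filterS => q cq; rewrite /= fct_sumE; apply: eq_bigr => k _.
  by rewrite [LHS]/(Y k (c q) * Y k (c q)) /Y cmapK.
rewrite /continuous_at -(nbhs_singleton nE).
apply: cvg_trans; first exact: (near_eq_cvg nE).
by apply: continuous_comp; [exact: cmap_continuous|exact: cu].
Qed.

Lemma normal_partB p v w :
  normal_part X p (v - w) = normal_part X p v - normal_part X p w.
Proof. by rewrite !normal_partE mulmxBl opprD addrACA -opprD. Qed.

Lemma normal_partZ p a v : normal_part X p (a *: v) = a *: normal_part X p v.
Proof. by rewrite !normal_partE scalerBr scalemxAl. Qed.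

(** The normal projection is self-adjoint and fixes [X p], so a second derivative and its normal
    part have the same product with [X p]. Removing the radial component therefore commutes with the
    projection, and with the trace by linearity. *)
Lemma sphere_mean_curvatureE p : normal_part X p (X p) = X p ->
  sphere_mean_curvature X p = mean_curvature X p -
    (dot (mean_curvature X p) (X p) / dot (X p) (X p)) *: X p.
Proof.
move=> nX; rewrite /sphere_mean_curvature /mean_curvature /metric_trace.
rewrite dot_suml mulr_suml scaler_suml -sumrB; apply: eq_bigr => i _.
rewrite dot_suml mulr_suml scaler_suml -sumrB; apply: eq_bigr => j _.
rewrite /sphere_second_form /second_form /sphere_tangent_part.
move: (second_diff X p i j) => s.
rewrite normal_partB normal_partZ nX scalerBr dotZl normal_part_dot nX.
by rewrite scalerA mulrA.
Qed.

End SphereImmersion.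

Theorem theorem6p1 (R : realType) (n m : nat) (hn : (1 <= n)%N)
    (hm : (1 <= m)%N) (Sigma : riemannian R n) (X : Sigma -> 'rV[R]_(n + m))
    (lambda : R) (hX : self_shrinker X lambda) (hS : parabolic Sigma) :
  (exists p : Sigma, Num.sqrt (n%:R / lambda) < enorm (X p)) \/
  (range X `<=` esphere (Num.sqrt (n%:R / lambda)) /\
   minimal_immersion_in_sphere X (Num.sqrt (n%:R / lambda))).
Proof.
have [_ isoX lam0 shrink] := hX.
have [|inside] := pselect (exists p, Num.sqrt (n%:R / lambda) < enorm (X p)).
  by left.
right; have n0 : 0 < n%:R :> R by rewrite ltr0n.
have r0 : 0 < n%:R / lambda by rewrite divr_gt0.
have le_r p : sqnorm X p <= n%:R / lambda.
  rewrite leNgt; apply/negP => lt; apply: inside; exists p.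
  by rewrite /enorm ltr_sqrt// (lt_trans r0).
(* The tangential component of the position vector; the squared norm of the normal one is
   [sqnorm X p - dot (T p) (T p)]. *)
pose T p := X p *m tangent_projection (diff_at X p).
have lapE p : laplacian (sqnorm X) p =
    2 * (n%:R - lambda * (sqnorm X p - dot (T p) (T p))).
  by rewrite (laplacian_sqnorm isoX) shrink dotZl (dot_normal_part isoX) mulNr.
have lam_le p : lambda * sqnorm X p <= n%:R.
  by rewrite mulrC -ler_pdivlMr.
have T0 p : 0 <= lambda * dot (T p) (T p) by rewrite mulr_ge0 ?dot_ge0// ltW.
have sub : subharmonic (sqnorm X).
  move=> p U phi oU Up Cphi phip le_phi.
  apply: le_trans (laplacian_le isoX oU Up Cphi phip le_phi).
  by rewrite lapE; have := lam_le p; have := T0 p; lra.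
have cst_norm : forall p q, sqnorm X p = sqnorm X q.
  by apply: hS sub _; [exact: sqnorm_continuous|exists (n%:R / lambda)].
have lap0 p : laplacian (sqnorm X) p = 0.
  have -> : sqnorm X = cst (sqnorm X p) by apply/funext => q; exact: cst_norm.
  exact: laplacian_cst.
(* Half the Laplacian is the sum of two nonnegative terms, [n - lambda |X|^2] and [lambda |T|^2], so
   both vanish with it. *)
have TX0 p : lambda * dot (T p) (T p) = 0.
  by have := lap0 p; rewrite lapE; have := lam_le p; have := T0 p; lra.
have norm_r p : sqnorm X p = n%:R / lambda.
  apply: (mulfI (lt0r_neq0 lam0)); rewrite [RHS]mulrC divfK ?gt_eqF//.
  by have := lap0 p; have := TX0 p; rewrite lapE; lra.
have nX p : normal_part X p (X p) = X p.
  rewrite normal_partE -/(T p) (_ : T p = 0) ?subr0//.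
  apply: dot_eq0; apply: (mulfI (lt0r_neq0 lam0)); by rewrite TX0 mulr0.
have onS p : esphere (Num.sqrt (n%:R / lambda)) (X p).
  by rewrite /esphere /= /enorm -(norm_r p).
split; first by move=> _ [p _ <-].
(* The mean curvature vector is now [- lambda *: X p], whose radial coefficient is [- lambda], so
   the difference cancels; the division is legitimate because [|X|^2 = n / lambda] is positive. *)
split => // p; rewrite sphere_mean_curvatureE// shrink nX dotZl mulfK ?subrr//.
by rewrite -/(sqnorm X p) norm_r gt_eqF.
Qed.
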